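(* Let $\mu>0$, $\lambda\in(0,1)$ and let $\alpha_0,\alpha_1,\dots,\alpha_n$ be angles. Consider the $n$-agent cyclic constant bearing (CB) pursuit system with beacon, whose shape dynamics (given in the context) are parametrized by $\mu$, $\lambda$ and the CB parameters $\{\alpha_0,\alpha_1,\dots,\alpha_n\}$. The following statements are true. (a) The only possible relative equilibria are circling equilibria. (b) Whenever $\sin\left(\sum_{i=1}^n\alpha_i\right)\neq 0$, a circling equilibrium exists if and only if there exist $m\in\mathbb{Z}$ and $\sigma=(\sigma_1,\sigma_2,\dots,\sigma_n)\in\{-1,1\}^n$ such that (i) the number $M$ of indices $i\in\{1,\dots,n\}$ with $\sigma_i=1$ satisfies $2M-n\neq 0$, and (ii) $\lambda\cos\alpha_0+(1-\lambda)\sin\alpha^*>0$ and $\sin(\alpha^*+\sigma_i\alpha_i)>0$ for $i=1,2,\dots,n$, where $\alpha^*$ is given by $$\alpha^*=\left(\frac{m+M-n}{2M-n}\right)\pi-\sum_{i=1}^n\left(\frac{\alpha_i}{2M-n}\right).$$ At equilibrium, we have either $\kappa_{ib}=\pi/2$ for $i=1,2,\dots,n$ or $\kappa_{ib}=-\pi/2$ for $i=1,2,\dots,n$, and the equilibrium values of $\kappa_i$, $\rho_{ib}$ and $\rho_i$ are given by $$\kappa_i=\frac{\pi(1-\sigma_i)}{2}+(\sigma_i\alpha^*+\alpha_i)=\begin{cases}\alpha^*+\alpha_i,&\text{if }\sigma_i=+1,\\ \pi-\alpha^*+\alpha_i,&\text{if }\sigma_i=-1,\end{cases}$$ $$\rho_{ib}=\frac{\lambda}{\mu\lambda\cos\alpha_0+\mu(1-\lambda)\sin\kappa_{ib}\,\sin\alpha^*},\qquad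 \rho_i=2\rho_{ib}\sin\kappa_{ib}\sin\kappa_i.$$
   Context: Setting: $n$ unit-speed agents in the plane with positions $\mathbf r_i$ and unit headings $\mathbf x_i$, and a fixed beacon at $\mathbf r_b$. Agent indices are modulo $n$; agent $i$ attends to agent $i+1$ and to the beacon. $R(\vartheta)=\begin{bmatrix}\cos\vartheta&-\sin\vartheta\\ \sin\vartheta&\cos\vartheta\end{bmatrix}$ is the planar rotation, and $\mathbb{I}_2$ the $2\times2$ identity. Shape variables, for $i=1,\dots,n$: $\rho_i=|\mathbf r_{i+1}-\mathbf r_i|$; $\rho_{ib}=|\mathbf r_b-\mathbf r_i|$; and angles (modulo $2\pi$) $\kappa_i,\theta_i,\kappa_{ib}$ defined by $R(\kappa_i)\mathbf x_i=(\mathbf r_{i+1}-\mathbf r_i)/\rho_i$, $R(\theta_i)\mathbf x_i=-(\mathbf r_i-\mathbf r_{i-1})/\rho_{i-1}$, $R(\kappa_{ib})\mathbf x_i=(\mathbf r_b-\mathbf r_i)/\rho_{ib}$. The shape space is the set of all $(\rho_i,\kappa_i,\theta_i,\rho_{ib},\kappa_{ib})_{i=1}^n$ with $\rho_i>0$, $\rho_{ib}>0$, satisfying the constraints $$R\Big(\sum_{i=1}^n(\pi+\kappa_i-\theta_{i+1})\Big)=\mathbb{I}_2,\qquad \rho_i\mathbb{I}_2=\rho_{ib}R(\kappa_{ib}-\kappa_i)+\rho_{i+1,b}R(\kappa_{i+1,b}-\theta_{i+1}),\quad i=1,\dots,n.$$ Closed-loop shape dynamics with parameters $\mu,\lambda,\alpha_0,\alpha_1,\dots,\alpha_n$,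 for $i=1,\dots,n$: $$\begin{aligned} \dot\rho_i&=-(\cos\kappa_i+\cos\theta_{i+1}),\\ \dot\kappa_i&=-\mu\big[(1-\lambda)\sin(\kappa_i-\alpha_i)+\lambda\sin(\kappa_{ib}-\alpha_0)\big]+\tfrac{\lambda}{\rho_i}\big[\sin\kappa_i+\sin\theta_{i+1}\big],\\ \dot\theta_i&=\dot\kappa_i-\tfrac1{\rho_i}\big[\sin\kappa_i+\sin\theta_{i+1}\big]+\tfrac1{\rho_{i-1}}\big[\sin\kappa_{i-1}+\sin\theta_i\big],\\ \dot\rho_{ib}&=-\cos\kappa_{ib},\\ \dot\kappa_{ib}&=\dot\kappa_i-\tfrac1{\rho_i}\big[\sin\kappa_i+\sin\theta_{i+1}\big]+\tfrac1{\rho_{ib}}\sin\kappa_{ib}. \end{aligned}$$ A relative equilibrium is an equilibrium point of these dynamics lying in the shape space. A circling equilibrium is a relative equilibrium at which all agents move on a common circle centered at the beacon (all $\rho_{ib}$ are equal), in the same rotational sense.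
   Formalization: For equilibria with κ_ib = −π/2, the α* satisfying (ii) would give ρ_i < 0; the formal statement uses in the value formulas the α* for m while (ii) holds for m+(2M−n), i.e. for α*+π. For κ_ib = π/2 it is as stated. *)

(* Defs.v *)
From HB Require Import structures.
From mathcomp Require Import all_boot all_order all_algebra.
From mathcomp Require Import all_classical all_reals all_analysis.

Set Implicit Arguments.
Unset Strict Implicit.
Unset Printing Implicit Defensive.
Import Order.TTheory GRing.Theory Num.Theory.

Local Open Scope ring_scope.

Definition rotation {R : realType} (t : R) : 'M[R]_2 :=
  \matrix_(i < 2, j < 2)
    (if i == j then cos t else if (i < j)%N then - sin t else sin t).

(* Angles are real numbers read modulo 2 pi. *)
Definition eq_angle {R : realType} (a b : R) : Prop :=
  exists k : int, a = b + k%:~R * (2 * pi).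

(* Agents are indexed by 'I_n instead of 1, ..., n; the indices i + 1 and i - 1
   modulo n are ordS i and ord_pred i. The angles kappa, theta, kappa_b are
   real representatives, so a point of the shape space may have several
   representatives, all equal up to eq_angle. *)
Record shape_point (R : realType) (n : nat) := ShapePoint {
  rho : 'I_n -> R;
  kappa : 'I_n -> R;
  theta : 'I_n -> R;
  rho_b : 'I_n -> R;
  kappa_b : 'I_n -> R
}.

Definition in_shape_space {R : realType} {n : nat} (s : shape_point R n) : Prop :=
  [/\ forall i, 0 < rho s i,
      forall i, 0 < rho_b s i,
      rotation (\sum_(i < n) (pi + kappa s i - theta s (ordS i))) = 1%:M
    & forall i, (rho s i)%:M =
        rho_b s i *: rotation (kappa_b s i - kappa s i)
        + rho_b s (ordS i) *: rotation (kappa_b s (ordS i) - theta s (ordS i))].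

Section Dynamics.
Context {R : realType} {n : nat}.
Variables (mu lambda alpha0 : R) (alpha : 'I_n -> R) (s : shape_point R n).

Definition rho_dot (i : 'I_n) : R :=
  - (cos (kappa s i) + cos (theta s (ordS i))).

Definition kappa_dot (i : 'I_n) : R :=
  - mu * ((1 - lambda) * sin (kappa s i - alpha i)
          + lambda * sin (kappa_b s i - alpha0))
  + lambda / rho s i * (sin (kappa s i) + sin (theta s (ordS i))).

Definition theta_dot (i : 'I_n) : R :=
  kappa_dot i
  - 1 / rho s i * (sin (kappa s i) + sin (theta s (ordS i)))
  + 1 / rho s (ord_pred i) * (sin (kappa s (ord_pred i)) + sin (theta s i)).

Definition rho_b_dot (i : 'I_n) : R := - cos (kappa_b s i).

Definition kappa_b_dot (i : 'I_n) : R :=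
  kappa_dot i
  - 1 / rho s i * (sin (kappa s i) + sin (theta s (ordS i)))
  + 1 / rho_b s i * sin (kappa_b s i).

Definition relative_equilibrium : Prop :=
  in_shape_space s /\
  forall i, [/\ rho_dot i = 0, kappa_dot i = 0, theta_dot i = 0,
                rho_b_dot i = 0 & kappa_b_dot i = 0].

(* Angular velocity of agent i about the beacon: since
   r_i - r_b = - rho_ib R(kappa_ib) x_i and the velocity of agent i is x_i,
   det (r_i - r_b, x_i) / |r_i - r_b|^2 = sin kappa_ib / rho_ib. *)
Definition angular_velocity (i : 'I_n) : R := sin (kappa_b s i) / rho_b s i.

(* The distance of each agent to the beacon is constant since rho_b_dot = 0. *)
Definition circling_equilibrium : Prop :=
  [/\ relative_equilibrium,
      forall i j, rho_b s i = rho_b s j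
    & (forall i, 0 < angular_velocity i) \/
      (forall i, angular_velocity i < 0)].

End Dynamics.

Definition sign_vector {n : nat} (sigma : 'I_n -> int) : Prop :=
  forall i, sigma i = 1 \/ sigma i = -1.

Definition nb_plus {n : nat} (sigma : 'I_n -> int) : nat :=
  #|[pred i | sigma i == 1]|.

Definition excess {n : nat} (sigma : 'I_n -> int) : int :=
  2 * (nb_plus sigma)%:Z - n%:Z.

Definition alpha_star {R : realType} {n : nat} (alpha : 'I_n -> R)
    (m : int) (sigma : 'I_n -> int) : R :=
  (m + (nb_plus sigma)%:Z - n%:Z)%:~R / (excess sigma)%:~R * pi
  - \sum_(i < n) alpha i / (excess sigma)%:~R.

Definition sign_conditions {R : realType} {n : nat} (lambda alpha0 : R)
    (alpha : 'I_n -> R) (m : int) (sigma : 'I_n -> int) : Prop :=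
  let a := alpha_star alpha m sigma in
  0 < lambda * cos alpha0 + (1 - lambda) * sin a /\
  forall i, 0 < sin (a + (sigma i)%:~R * alpha i).

Definition counterclockwise {R : realType} {n : nat} (s : shape_point R n) : Prop :=
  forall i, eq_angle (kappa_b s i) (pi / 2).

Definition clockwise {R : realType} {n : nat} (s : shape_point R n) : Prop :=
  forall i, eq_angle (kappa_b s i) (- (pi / 2)).

Definition equilibrium_values {R : realType} {n : nat}
    (mu lambda alpha0 : R) (alpha : 'I_n -> R)
    (m : int) (sigma : 'I_n -> int) (s : shape_point R n) : Prop :=
  let a := alpha_star alpha m sigma in
  forall i,
  [/\ eq_angle (kappa s i)
        (pi * (1 - (sigma i)%:~R) / 2 + ((sigma i)%:~R * a + alpha i)),
      rho_b s i = lambda / (mu * lambda * cos alpha0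
                   + mu * (1 - lambda) * sin (kappa_b s i) * sin a)
    & rho s i = 2 * rho_b s i * sin (kappa_b s i) * sin (kappa s i)].

(* Main.v *)
Require Import Defs.
From mathcomp Require Import all_boot all_order all_algebra.
From mathcomp Require Import all_classical all_reals all_analysis.
From mathcomp Require Import ring lra.
Import Order.TTheory GRing.Theory Num.Theory.
Local Open Scope ring_scope.

(* At an equilibrium cos kappa_ib = 0, and the equations for kappa_ib and theta_i
   say that sin kappa_ib / rho_ib does not depend on i; as sin kappa_ib = +-1,
   both e = sin kappa_ib and b = rho_ib are common to all agents, which is (a).
   Then theta_(i+1) = pi - kappa_i and rho_i = 2 b e sin kappa_i, and the
   equation for kappa_i says that sin (kappa_i - alpha_i) is common to all
   agents. With a = kappa_j - alpha_j for some fixed j, this gives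
   kappa_i = alpha_i + a or kappa_i = alpha_i + pi - a, which defines sigma_i.
   The closure constraint sum_i 2 kappa_i = 0 (mod 2 pi) becomes
   (2 M - n) a + sum_i alpha_i + (n - M) pi = m pi; it forces
   sin (sum_i alpha_i) = 0 if 2 M = n, and a = alpha* otherwise. *)

(** * Angles modulo 2 pi, and planar rotations *)

Section Angles.
Context {R : realType}.
Implicit Types (a b c d x : R) (k : int).

Lemma sin_int_pi k : sin (k%:~R * pi) = 0 :> R.
Proof.
have sinn n : sin (n%:R * pi) = 0 :> R.
  rewrite mulr_natl -[X in sin X]add0r (alternatingn (@sinDpi R)) sin0.
  exact: mulr0.
by case: k => n; rewrite ?NegzE ?mulrNz ?mulNr ?sinN -?pmulrn sinn ?oppr0.
Qed.

(** Subtracting floor (x / pi) times pi moves x into [0, pi), where the sine vanishes only at 0. *)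
Lemma sin_eq0 {x} : sin x = 0 -> exists k, x = k%:~R * pi.
Proof.
move=> sx0; have pi0 := pi_gt0 R.
set k := Num.floor (x / pi); exists k.
have /andP[kle ltk] := floor_itv (x / pi); rewrite -/k in kle ltk.
have y0 : 0 <= x - k%:~R * pi by rewrite subr_ge0 -ler_pdivlMr.
have ypi : x - k%:~R * pi < pi.
  by move: ltk; rewrite ltr_pdivrMr // intrD mulrDl mul1r ltrBlDl.
have : sin (x - k%:~R * pi) = 0 by rewrite sinB sx0 sin_int_pi; ring.
move: y0; rewrite le_eqVlt => /predU1P[/esym/eqP|y_gt0].
  by rewrite subr_eq0 => /eqP.
move=> sy0; have := @sin_gt0_pi _ (x - k%:~R * pi).
by rewrite y_gt0 ypi sy0 ltxx => /(_ isT).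
Qed.

Lemma cos_eq1 {x} : cos x = 1 -> exists k, x = k%:~R * (2 * pi).
Proof.
(* Half-angle formula: cos x = 1 - 2 sin (x / 2) ^ 2. *)
move=> cx1; have [|k xk] := @sin_eq0 (x / 2).
  have : cos (x / 2 + x / 2) = 1 by rewrite -[RHS]cx1; congr cos; field.
  rewrite cosD -!expr2 cos2sin2 => h; apply/eqP.
  by rewrite -[_ == 0](expf_eq0 _ 2); apply/eqP; lra.
by exists k; rewrite mulrCA -xk; field.
Qed.

Lemma cos_int_2pi k : cos (k%:~R * (2 * pi)) = 1 :> R.
Proof.
have -> : k%:~R * (2 * pi) = k%:~R * pi + k%:~R * pi :> R by ring.
by rewrite cosD -!expr2 cos2sin2 sin_int_pi; ring.
Qed.

Lemma sin_int_2pi k : sin (k%:~R * (2 * pi)) = 0 :> R.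
Proof. by rewrite mulrA -[2]/(2%:~R) -intrM sin_int_pi. Qed.

Lemma eq_angle_cos {a b} : eq_angle a b -> cos a = cos b.
Proof. by case=> k ->; rewrite cosD cos_int_2pi sin_int_2pi; ring. Qed.

Lemma eq_angle_sin {a b} : eq_angle a b -> sin a = sin b.
Proof. by case=> k ->; rewrite sinD cos_int_2pi sin_int_2pi; ring. Qed.

Lemma eq_angleP {a b} : cos a = cos b -> sin a = sin b -> eq_angle a b.
Proof.
move=> cab sab; have [|k abk] := @cos_eq1 (a - b).
  by rewrite cosB cab sab -!expr2 cos2Dsin2.
by exists k; rewrite -abk; ring.
Qed.

(** Equal sines force cosines equal up to sign, and that sign selects the alternative. *)
Lemma sin_eq {a b} : sin a = sin b -> eq_angle a b \/ eq_angle a (pi - b).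
Proof.
move=> sab; have : cos a ^+ 2 = cos b ^+ 2 by rewrite !cos2sin2 sab.
move/eqP; rewrite eqf_sqr => /orP[]/eqP cab; [left|right];
  by apply: eq_angleP => //; rewrite ?cosB ?sinB cospi sinpi ?cab ?sab; ring.
Qed.

Lemma eq_angleB {a b c d} :
  eq_angle a b -> eq_angle c d -> eq_angle (a - c) (b - d).
Proof. by case=> k -> [l ->]; exists (k - l); rewrite intrB; ring. Qed.

Lemma eq_angle_sum {I : finType} {f g : I -> R} :
  (forall i, eq_angle (f i) (g i)) -> eq_angle (\sum_i f i) (\sum_i g i).
Proof.
case/fin_all_exists => k fg; exists (\sum_i k i).
by rewrite rmorph_sum mulr_suml -big_split; apply: eq_bigr => i _; exact: fg.
Qed.

Lemma rotation_eq1 {x} : rotation x = 1%:M <-> cos x = 1.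
Proof.
split=> [/matrixP/(_ ord0 ord0)|cx1]; first by rewrite !mxE.
have sx0 : sin x = 0 by apply: cos1sin0; rewrite cx1 normr1.
by apply/matrixP => i j; rewrite !mxE cx1 sx0 oppr0 if_same; case: eqP.
Qed.

Lemma scalar_mx_rotation r b c x y :
  r = b * cos x + c * cos y -> b * sin x + c * sin y = 0 ->
  r%:M = b *: rotation x + c *: rotation y.
Proof.
move=> -> s0; apply/matrixP => i j; rewrite !mxE.
by case: eqP => //= _; rewrite ?mulr1n ?mulr0n; case: ifP => _ //; lra.
Qed.

(** For sg = -1 the angle is pi - (a - al), and the sine is invariant under t -> pi - t. This reads
    the second sign condition as sin kappa_i > 0. *)
Lemma sin_pursuit_angle (sg : int) a (al : R) : sg = 1 \/ sg = -1 ->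
  sin (pi * (1 - sg%:~R) / 2 + (sg%:~R * a + al)) = sin (a + sg%:~R * al).
Proof.
case=> ->.
  by congr sin; lra.
rewrite (_ : _ / 2 + _ = pi - (a + (-1)%:~R * al)); last by rewrite intrN; lra.
by rewrite sinB cospi sinpi; ring.
Qed.

End Angles.

(** Stepping down from any index reaches 0 without wrapping around. *)
Lemma ord_pred_const {T : Type} {n : nat} (f : 'I_n -> T) :
  (forall i, f i = f (ord_pred i)) -> forall i j, f i = f j.
Proof.
case: n f => [|n] f fP; first by case.
suff f0 (i : 'I_n.+1) : f i = f ord0 by move=> i j; rewrite !f0.
case: i => m; elim: m => [|m IHm] ltm.
  by congr f; apply: val_inj.
rewrite fP -(IHm (ltnW ltm)); congr f; apply: val_inj => /=.
by rewrite modnDr modn_small // ltnW.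
Qed.

(** * Sign vectors and the closure equation defining alpha* *)

Section Signs.
Context {R : realType} {n : nat}.
Variables (alpha : 'I_n -> R) (sigma : 'I_n -> int).
Hypothesis sigmaP : sign_vector sigma.

(** Each sign is 2 [sigma_i = 1] - 1. *)
Lemma sum_sign_vector : \sum_i sigma i = excess sigma.
Proof.
rewrite /excess /nb_plus -sum1_card big_mkcond /=.
transitivity (\sum_i (2 * ((sigma i == 1) : nat)%:Z - 1)).
  by apply: eq_bigr => i _; case: (sigmaP i) => ->.
rewrite sumrB sumr_const card_ord -mulr_sumr.
congr (2 * _ - _); last exact: natz.
rewrite (big_morph _ PoszD (erefl _)) [RHS]big_mkcond; apply: eq_bigr => i _.
by rewrite inE; case: eqP.
Qed.

Lemma sum_pursuit_angles (a : R) :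
  \sum_i (pi * (1 - (sigma i)%:~R) / 2 + ((sigma i)%:~R * a + alpha i)) =
  (excess sigma)%:~R * a + \sum_i alpha i
  - ((nb_plus sigma)%:Z - n%:Z)%:~R * pi.
Proof.
rewrite !big_split /= -!mulr_suml -mulr_sumr sumrB sumr_const card_ord.
rewrite -rmorph_sum /= sum_sign_vector /excess !(intrB, intrM) -!pmulrn.
by field.
Qed.

(** Left to right, this identifies alpha* at a given equilibrium; right to left, it gives closure of
    the constructed one. *)
Lemma alpha_star_eq (m : int) (a : R) : excess sigma <> 0 ->
  (excess sigma)%:~R * a + \sum_i alpha i
    - ((nb_plus sigma)%:Z - n%:Z)%:~R * pi = m%:~R * pi <->
  a = alpha_star alpha m sigma.
Proof.
move=> /eqP e0; rewrite /alpha_star -mulr_suml -addrA intrD.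
have {}e0 : (excess sigma)%:~R != 0 :> R by rewrite intr_eq0.
split=> [h|->]; last by field.
apply: (mulfI e0); rewrite (_ : _ * a = m%:~R * pi
  + ((nb_plus sigma)%:Z - n%:Z)%:~R * pi - \sum_i alpha i); first by field.
by rewrite -h; ring.
Qed.

(* Replacing m by m + excess sigma turns alpha* by pi; this converts the sign
   conditions of a clockwise equilibrium into those of statement (ii). *)
Lemma alpha_star_shift (m : int) : excess sigma <> 0 ->
  alpha_star alpha (m + excess sigma) sigma = alpha_star alpha m sigma + pi.
Proof.
move=> e0; apply/esym/alpha_star_eq => //.
have /= h := (alpha_star_eq m _ e0).2 erefl.
by rewrite [in RHS]intrD [RHS]mulrDl -h; ring.
Qed.

End Signs.

(** * Necessary form of the equilibria, and their construction *)

Section Equilibria.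
Context {R : realType} {n : nat}.
Variables (mu lambda alpha0 : R) (alpha : 'I_n -> R).
Hypotheses (mu_gt0 : 0 < mu).
Hypotheses (lambda_gt0 : 0 < lambda) (lambda_lt1 : lambda < 1).

(** Here [e] is the sense of rotation (1 for counterclockwise) and [b] the radius. *)
Definition common_circle (s : shape_point R n) (e b : R) : Prop :=
  [/\ e = 1 \/ e = -1, 0 < b &
    forall i, [/\ sin (kappa_b s i) = e, cos (kappa_b s i) = 0
                & rho_b s i = b]].

Lemma relative_equilibrium_common {s : shape_point R n} :
  relative_equilibrium mu lambda alpha0 alpha s ->
  exists e b : R, common_circle s e b.
Proof.
case=> -[rho0 rhob0 _ _] eqs.
have cb i : cos (kappa_b s i) = 0.
  by case: (eqs i) => _ _ _ + _; rewrite /rho_b_dot; lra.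
have sb i : sin (kappa_b s i) = 1 \/ sin (kappa_b s i) = -1.
  have : sin (kappa_b s i) ^+ 2 = 1 by rewrite sin2cos2 cb; ring.
  by move/eqP; rewrite sqrf_eq1 => /orP[]/eqP; [left|right].
have wE i : 1 / rho s i * (sin (kappa s i) + sin (theta s (ordS i))) =
            angular_velocity s i.
  case: (eqs i) => _ k0 _ _; rewrite /kappa_b_dot k0 /angular_velocity.
  by move=> h; rewrite mulrC; lra.
have wC : forall i j, angular_velocity s i = angular_velocity s j.
  apply: ord_pred_const => i.
  have := wE (ord_pred i); rewrite ord_predK => wp.
  by case: (eqs i) => _ k0 + _ _; rewrite /theta_dot k0 wE wp; lra.
(* With no agent to read [e] and [b] from, any admissible pair works. *)
case: (posnP n) => [n0|n_gt0].
  exists 1, 1; split=> [|//|i]; first by left.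
  by have := ltn_ord i; rewrite [X in (_ < X)%N]n0.
pose i0 := Ordinal n_gt0; exists (sin (kappa_b s i0)), (rho_b s i0).
split=> [//|//|i].
(* Equal ratios with numerators 1 or -1 and positive denominators have equal numerators, hence equal
   denominators. *)
have := wC i i0; move/eqP.
rewrite /angular_velocity eqr_div ?lt0r_neq0 // => /eqP.
have := rhob0 i; have := rhob0 i0.
case: (sb i) => ->; case: (sb i0) => -> *; split=> //; lra.
Qed.

Lemma relative_equilibrium_circling {s : shape_point R n} :
  relative_equilibrium mu lambda alpha0 alpha s ->
  circling_equilibrium mu lambda alpha0 alpha s.
Proof.
move=> eqs; have [e [b [e1 b0 eb]]] := relative_equilibrium_common eqs.
split=> // [i j|]; first by case: (eb i) (eb j) => _ _ -> [_ _ ->].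
case: e1 => e1; [left|right] => i; rewrite /angular_velocity.
  by case: (eb i) => -> _ ->; rewrite e1 divr_gt0.
by case: (eb i) => -> _ ->; rewrite e1 mulN1r oppr_lt0 invr_gt0.
Qed.

Lemma relative_equilibrium_angles {s : shape_point R n} {e b : R} :
  relative_equilibrium mu lambda alpha0 alpha s -> common_circle s e b ->
  forall i, [/\ eq_angle (theta s (ordS i)) (pi - kappa s i),
    rho s i = 2 * b * e * sin (kappa s i) &
    mu * ((1 - lambda) * sin (kappa s i - alpha i) + lambda * (e * cos alpha0))
      = lambda * e / b].
Proof.
case=> -[rho0 _ _ _] eqs [e1 b0 eb] i.
have {e1} ee : e * e = 1 by case: e1 => ->; ring.
have := rho0 i; case: (eqs i) (eb i).
rewrite /rho_dot /kappa_b_dot => r0 k0 _ _ + [sb cb rb] r_gt0.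
rewrite k0 sb rb => w0.
have w : 1 / rho s i * (sin (kappa s i) + sin (theta s (ordS i))) = e / b.
  by rewrite [e / b]mulrC; lra.
have rE : rho s i = b * e * (sin (kappa s i) + sin (theta s (ordS i))).
  have -> : sin (kappa s i) + sin (theta s (ordS i)) = rho s i * (e / b).
    by rewrite -w; field; rewrite gt_eqF.
  rewrite [RHS](_ : _ = rho s i * (e * e)); first by rewrite ee mulr1.
  by field; rewrite gt_eqF.
have cE : cos (theta s (ordS i)) = - cos (kappa s i) by lra.
have sE : sin (theta s (ordS i)) = sin (kappa s i).
  have : sin (theta s (ordS i)) ^+ 2 = sin (kappa s i) ^+ 2.
    by rewrite !sin2cos2 cE; ring.
  (* The opposite sign would give rho_i = 0. *)
  move/eqP; rewrite eqf_sqr => /orP[]/eqP // sE.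
  by move: r_gt0; rewrite rE sE subrr mulr0 ltxx.
split.
- by apply: eq_angleP; rewrite ?cosB ?sinB cospi sinpi ?cE ?sE; ring.
- by rewrite rE sE; ring.
move: k0; rewrite /kappa_dot (sinB (kappa_b s i)) sb cb.
have -> : lambda / rho s i * (sin (kappa s i) + sin (theta s (ordS i)))
  = lambda * (e / b) by rewrite -w; ring.
by rewrite -[lambda * e / b]mulrA; lra.
Qed.

Lemma equilibrium_parameters {s : shape_point R n} {e b : R} :
  sin (\sum_i alpha i) <> 0 ->
  relative_equilibrium mu lambda alpha0 alpha s -> common_circle s e b ->
  exists (m : int) (sigma : 'I_n -> int),
    [/\ sign_vector sigma, excess sigma <> 0,
      lambda / b = mu * lambda * cos alpha0
        + mu * (1 - lambda) * e * sin (alpha_star alpha m sigma)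
    & forall i, eq_angle (kappa s i)
        (pi * (1 - (sigma i)%:~R) / 2
         + ((sigma i)%:~R * alpha_star alpha m sigma + alpha i))].
Proof.
move=> sa eqs com; have ang := relative_equilibrium_angles eqs com.
case: com => e1 b0 _.
(* An empty sum has sine 0, so the hypothesis on the sum supplies a reference agent. *)
have [i0 _] : exists i : 'I_n, true.
  case: (posnP n) => [n0|n_gt0]; last by exists (Ordinal n_gt0).
  case: sa; rewrite big1 ?sin0 // => i _.
  by have := ltn_ord i; rewrite [X in (_ < X)%N]n0.
pose a := kappa s i0 - alpha i0.
have saE i : sin (kappa s i - alpha i) = sin a.
  have [_ _ h] := ang i; have [_ _] := ang i0; rewrite -h -/a.
  move/(mulfI (lt0r_neq0 mu_gt0))/addIr/mulfI => -> //.
  by rewrite subr_eq0 gt_eqF.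
have /fin_all_exists[sigma sigmaP] i : exists sg : int, (sg = 1 \/ sg = -1) /\
    eq_angle (kappa s i) (pi * (1 - sg%:~R) / 2 + (sg%:~R * a + alpha i)).
  by case: (sin_eq (saE i)) => -[k hk]; [exists 1|exists (-1)];
    (split; [by [left|right]|exists k; rewrite ?intrN; lra]).
have {}sg i : sigma i = 1 \/ sigma i = -1 by case: (sigmaP i).
have kE i := (sigmaP i).2.
(* Each closure term is 2 kappa_i modulo 2 pi; halving leaves a multiple of pi, whose parity is
   free. *)
have [k sumk] : exists k : int, \sum_i kappa s i = k%:~R * pi.
  case: eqs => -[_ _ + _] _ => /rotation_eq1.
  have h i : eq_angle (pi + kappa s i - theta s (ordS i))
    (pi + kappa s i - (pi - kappa s i)).
    by apply: eq_angleB; [exists 0; rewrite mul0r addr0|case: (ang i)].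
  rewrite (eq_angle_cos (eq_angle_sum h)) => /cos_eq1[k hk]; exists k.
  have : 2 * \sum_i kappa s i = k%:~R * (2 * pi).
    by rewrite -hk mulr_sumr; apply: eq_bigr => i _; ring.
  by lra.
have [m hm] : exists m : int, (excess sigma)%:~R * a + \sum_i alpha i
    - ((nb_plus sigma)%:Z - n%:Z)%:~R * pi = m%:~R * pi.
  have [l] := eq_angle_sum kE; rewrite sum_pursuit_angles // sumk => h.
  (* The term 2 l accounts for the kappa_i being known only modulo 2 pi. *)
  by exists (k - 2 * l); rewrite [in RHS]intrB intrM; lra.
have ex0 : excess sigma <> 0.
  move=> ex0; case: sa.
  have -> : \sum_i alpha i = (m + ((nb_plus sigma)%:Z - n%:Z))%:~R * pi.
    by move: hm; rewrite ex0 mul0r (intrD _ m) mulrDl; lra.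
  exact: sin_int_pi.
exists m, sigma; have <- := (alpha_star_eq alpha sigma m a ex0).1 hm.
split=> //; have [_ _] := ang i0; rewrite -/a.
(* This is the kappa equation multiplied by [e], with e ^ 2 = 1. *)
by case: e1 => ->; rewrite -mulrA; nra.
Qed.

(** The sign conditions express lambda / b > 0 and rho_i > 0. When e = -1, both hold with alpha* +
    pi in place of alpha*, hence the shifted integer. *)
Lemma circling_equilibrium_values (s : shape_point R n) :
  sin (\sum_i alpha i) <> 0 ->
  circling_equilibrium mu lambda alpha0 alpha s ->
  exists (m : int) (sigma : 'I_n -> int),
    [/\ sign_vector sigma, excess sigma <> 0,
        (counterclockwise s /\ sign_conditions lambda alpha0 alpha m sigma) \/
        (clockwise s /\
           sign_conditions lambda alpha0 alpha (m + excess sigma) sigma)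
      & equilibrium_values mu lambda alpha0 alpha m sigma s].
Proof.
move=> sa [eqs _ _]; have [e [b com]] := relative_equilibrium_common eqs.
have [m [sigma [sg ex0 bE kE]]] := equilibrium_parameters sa eqs com.
have ang := relative_equilibrium_angles eqs com.
case: com eqs => e1 b0 eb [[rho0 _ _ _] _].
have skE i : sin (kappa s i) =
    sin (alpha_star alpha m sigma + (sigma i)%:~R * alpha i).
  by rewrite (eq_angle_sin (kE i)) sin_pursuit_angle.
have esk i : 0 < e * sin (kappa s i).
  have := rho0 i; have [_ -> _] := ang i.
  by rewrite -(mulrA _ e) pmulr_rgt0 // mulr_gt0.
have lb0 : 0 < lambda / b by rewrite divr_gt0.
exists m, sigma; split=> // [|a i]; last first.
  have [sb _ rb] := eb i; split=> //; rewrite sb rb.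
    by rewrite -bE invf_div mulrC divfK // lt0r_neq0.
  by have [_ ->] := ang i.
case: e1 => e1; [left|right]; rewrite {}e1 in bE eb esk.
  split=> [i|]; first by case: (eb i) => sb cb _; apply: eq_angleP;
    rewrite ?sb ?cb ?cos_pihalf ?sin_pihalf.
  split=> [|i]; last by rewrite -skE -[sin _]mul1r.
  by rewrite -(pmulr_rgt0 _ mu_gt0); move: lb0; rewrite bE; lra.
split=> [i|]; first by case: (eb i) => sb cb _; apply: eq_angleP;
  rewrite ?cosN ?sinN ?sb ?cb ?cos_pihalf ?sin_pihalf.
rewrite /sign_conditions alpha_star_shift // sinDpi; split=> [|i].
  by rewrite -(pmulr_rgt0 _ mu_gt0); move: lb0; rewrite bE; lra.
by rewrite addrAC sinDpi -skE; move: (esk i); lra.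
Qed.

Lemma exists_circling_equilibrium (m : int) (sigma : 'I_n -> int) :
  sign_vector sigma -> excess sigma <> 0 ->
  sign_conditions lambda alpha0 alpha m sigma ->
  exists s : shape_point R n,
    [/\ circling_equilibrium mu lambda alpha0 alpha s, counterclockwise s
      & equilibrium_values mu lambda alpha0 alpha m sigma s].
Proof.
move=> sg ex0 []; set a := alpha_star alpha m sigma => c0 ci.
(* The value that the kappa equation forces on lambda / b when e = 1. *)
pose d := mu * lambda * cos alpha0 + mu * (1 - lambda) * sin a.
have d0 : 0 < d by move: c0; rewrite -(pmulr_rgt0 _ mu_gt0) /d; lra.
pose b := lambda / d; have b0 : 0 < b by rewrite divr_gt0.
pose k i := pi * (1 - (sigma i)%:~R) / 2 + ((sigma i)%:~R * a + alpha i).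
have sk i : 0 < sin (k i) by rewrite sin_pursuit_angle.
have ska i : sin (k i - alpha i) = sin a.
  rewrite (_ : k i - _ =
    pi * (1 - (sigma i)%:~R) / 2 + ((sigma i)%:~R * a + 0)).
    by rewrite sin_pursuit_angle // mulr0 addr0.
  by rewrite /k; ring.
have ck i : cos (pi - k i) = - cos (k i) by rewrite cosB cospi sinpi; ring.
have skp i : sin (pi - k i) = sin (k i) by rewrite sinB cospi sinpi; ring.
have sumk : \sum_i k i = m%:~R * pi.
  by rewrite sum_pursuit_angles //; apply/alpha_star_eq.
pose s := ShapePoint (fun i => 2 * b * sin (k i)) k
  (fun i => pi - k (ord_pred i)) (fun=> b) (fun=> pi / 2).
have w i : 1 / rho s i * (sin (kappa s i) + sin (theta s (ordS i))) = 1 / b.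
  by rewrite /= ordSK skp; field; rewrite !lt0r_neq0.
have kd i : kappa_dot mu lambda alpha0 alpha s i = 0.
  rewrite /kappa_dot [X in _ + X](_ : _ = lambda * (1 / b)); last first.
    by rewrite -(w i); ring.
  rewrite /= ska sinB sin_pihalf cos_pihalf /b /d.
  by field; rewrite !lt0r_neq0.
exists s; split.
- apply: relative_equilibrium_circling; split.
    split=> [i|i||i]; [by apply: mulr_gt0 => //; rewrite pmulr_rgt0|by []| |].
      apply/rotation_eq1; rewrite (_ : \sum_i _ = m%:~R * (2 * pi)).
        exact: cos_int_2pi.
      rewrite mulrCA -sumk mulr_sumr; apply: eq_bigr => i _.
      by rewrite /= ordSK; ring.
    (* The rotation angles pi / 2 - k_i and k_i - pi / 2 are opposite: the sines cancel and the
       cosines add up to 2 sin k_i. *)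
    apply: scalar_mx_rotation; rewrite /= ordSK.
      by rewrite !cosB !sinB cos_pihalf sin_pihalf cospi sinpi; ring.
    by rewrite !sinB !cosB cos_pihalf sin_pihalf cospi sinpi; ring.
  move=> i; split=> //.
  + by rewrite /rho_dot /= ordSK ck; ring.
  + have := w (ord_pred i); rewrite ord_predK => wp.
    by rewrite /theta_dot kd w wp; ring.
  + by rewrite /rho_b_dot /= cos_pihalf oppr0.
  by rewrite /kappa_b_dot kd w /= sin_pihalf; ring.
- by move=> i; exists 0; rewrite mul0r addr0.
move=> i; split=> /=; first by exists 0; rewrite mul0r addr0.
  by rewrite sin_pihalf mulr1.
by rewrite sin_pihalf mulr1.
Qed.

End Equilibria.

Theorem proposition4p1 (R : realType) (n : nat) (mu lambda alpha0 : R)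
    (alpha : 'I_n -> R) (mu_gt0 : 0 < mu)
    (lambda_gt0 : 0 < lambda) (lambda_lt1 : lambda < 1) :
  (forall s : shape_point R n, relative_equilibrium mu lambda alpha0 alpha s ->
     circling_equilibrium mu lambda alpha0 alpha s)
  /\
  (sin (\sum_(i < n) alpha i) <> 0 ->
   [/\ (exists s : shape_point R n, circling_equilibrium mu lambda alpha0 alpha s)
       <->
       (exists (m : int) (sigma : 'I_n -> int),
          [/\ sign_vector sigma, excess sigma <> 0
            & sign_conditions lambda alpha0 alpha m sigma]),
       forall s : shape_point R n, circling_equilibrium mu lambda alpha0 alpha s ->
         exists (m : int) (sigma : 'I_n -> int),
           [/\ sign_vector sigma, excess sigma <> 0,
               (counterclockwise s /\
                  sign_conditions lambda alpha0 alpha m sigma)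
               \/
               (clockwise s /\
                  sign_conditions lambda alpha0 alpha (m + excess sigma) sigma)
             & equilibrium_values mu lambda alpha0 alpha m sigma s]
     & forall (m : int) (sigma : 'I_n -> int),
         sign_vector sigma -> excess sigma <> 0 ->
         sign_conditions lambda alpha0 alpha m sigma ->
         exists s : shape_point R n,
           [/\ circling_equilibrium mu lambda alpha0 alpha s,
               counterclockwise s
             & equilibrium_values mu lambda alpha0 alpha m sigma s]]).
Proof.
split=> [s|sa]; first exact: relative_equilibrium_circling.
split; last first.
- by move=> m sigma; exact: exists_circling_equilibrium.
- by move=> s; exact: circling_equilibrium_values.
split=> [[s /circling_equilibrium_values]|[m [sigma [sg ex0 sc]]]].
  move=> /(_ mu_gt0 lambda_gt0 lambda_lt1 sa)[m [sigma [sg ex0 [] [_ sc] _]]].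
    by exists m, sigma.
  (* A clockwise equilibrium meets the sign conditions at the shifted integer. *)
  by exists (m + excess sigma), sigma.
have [//|s [cs _ _]] :=
  exists_circling_equilibrium _ _ _ _ mu_gt0 _ m sigma sg ex0 sc.
by exists s.
Qed.
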